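(* Let $N(t)$, $t\ge0$, be a homogeneous Poisson process of rate $\lambda>0$, let $\alpha>0$, and let $$\mathcal N^\alpha(t)=\frac1{\Gamma(\alpha)}\int_0^t(t-s)^{\alpha-1}N(s)\,\mathrm ds .$$ Then for every $t>0$ and every integer $n\ge0$, $$\operatorname{Var}\bigl(\mathcal N^\alpha(t)\,\big|\,N(t)=n\bigr)=\frac{n\,t^{2\alpha}\,\alpha^2}{(2\alpha+1)\,\Gamma^2(\alpha+2)} .$$
   Context: Here $\Gamma^2(x)=(\Gamma(x))^2$. $\operatorname{Var}(\,\cdot\,|\,N(t)=n)$ is the variance under the conditional probability given the event $\{N(t)=n\}$. *)

(* Defs.v *)
From HB Require Import structures.
From mathcomp Require Import all_boot all_order all_algebra.
From mathcomp Require Import all_classical all_reals all_analysis.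

Set Implicit Arguments.
Unset Strict Implicit.
Unset Printing Implicit Defensive.

Import Order.TTheory GRing.Theory Num.Theory.
Import numFieldNormedType.Exports.

Local Open Scope classical_set_scope.
Local Open Scope ring_scope.

Definition Gamma (R : realType) (a : R) : R :=
  \int[lebesgue_measure]_(x in `]0, +oo[) (x `^ (a - 1) * expR (- x)).

(* Choosing [B i = setT] for some of the indices gives the product rule for
   every subfamily. *)
Definition mutually_independent (d d' : measure_display) (R : realType)
    (T : measurableType d) (T' : measurableType d') (P : probability T R)
    (I : finType) (X : I -> T -> T') : Prop :=
  forall B : I -> set T', (forall i, measurable (B i)) ->
    P (\bigcap_(i in [set: I]) (X i @^-1` B i)) =
    (\prod_(i : I) P (X i @^-1` B i))%E.

(* Only the times [t >= 0] matter: nothing is assumed on [N t] for [t < 0],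
   except that it is measurable.  The truncated subtractions of [nat] are
   genuine ones by [poisson_nondecreasing].  Right-continuity is with respect
   to the discrete topology of [nat]. *)
Record poisson_process (d : measure_display) (R : realType)
    (T : measurableType d) (P : probability T R) (lambda : R)
    (N : R -> {RV P >-> nat}) : Prop := PoissonProcess {
  poisson_start : forall w, N 0 w = 0%N ;
  poisson_nondecreasing : forall w (s t : R), 0 <= s -> s <= t ->
    (N s w <= N t w)%N ;
  poisson_right_continuous : forall w (t : R), 0 <= t ->
    N s w @[s --> t^'+] --> N t w ;
  poisson_independent_increments : forall (k : nat) (t : nat -> R),
    0 <= t 0%N -> (forall i, t i <= t i.+1) ->
    mutually_independent P
      (fun (i : 'I_k) (w : T) => (N (t i.+1) w - N (t i) w)%N) ;
  poisson_increment_distribution : forall (s t : R) (k : nat),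
    0 <= s -> s < t ->
    P [set w | (N t w - N s w)%N = k] =
    (poisson_pmf (lambda * (t - s)) k)%:E
}.

(* Riemann-Liouville fractional integral, path by path; the value of the
   integrand at the endpoint [s = t] is immaterial. *)
Definition fractional_integral (T : Type) (R : realType)
    (alpha : R) (N : R -> T -> nat) (t : R) (w : T) : R :=
  (Gamma alpha)^-1 *
  \int[lebesgue_measure]_(s in `[0, t]) ((t - s) `^ (alpha - 1) * (N s w)%:R).

Lemma measurable_event (d : measure_display) (R : realType)
    (T : measurableType d) (P : probability T R) (X : {RV P >-> nat}) (n : nat) :
  measurable [set w | X w = n].
Proof. by rewrite -[X in _ X]/(X @^-1` [set n]); apply: measurable_funPTI. Qed.

(* The probability [B |-> P (B `&` A) / P A]; by convention it is [P] when
   [P A = 0]. *)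
Definition conditional_probability (d : measure_display) (R : realType)
    (T : measurableType d) (P : probability T R) (A : set T)
    (mA : measurable A) : probability T R :=
  mnormalize (mrestr P mA) P.
Arguments conditional_probability {d R T} P {A} mA.

(* Main.v *)
Require Import Defs.
From HB Require Import structures.
From mathcomp Require Import all_boot all_order all_algebra.
From mathcomp Require Import all_classical all_reals all_analysis.
From mathcomp Require Import measurable_realfun.
From mathcomp Require Import zify ring lra.

Set Implicit Arguments.
Unset Strict Implicit.
Unset Printing Implicit Defensive.

Import Order.TTheory GRing.Theory Num.Theory.
Import numFieldNormedType.Exports.

Local Open Scope classical_set_scope.
Local Open Scope ring_scope.

(** Given N t = n, the n jump times of the process are distributed as
    independent uniform points U_1, ..., U_n of [0, t]. As N s counts the points
    below s, exchanging the sum and the integral gives the fractional integral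
    as the sum of the (t - U_i) ^ alpha / Gamma (alpha + 1), whose variance is n
    times that of one term,

      t ^ (2 alpha) / Gamma (alpha + 1) ^ 2
        * (1 / (2 alpha + 1) - 1 / (alpha + 1) ^ 2),

    and Gamma (alpha + 2) = (alpha + 1) Gamma (alpha + 1) finishes the
    computation.

    The jump times themselves are never constructed: only two moments are
    needed, and these depend on the first two mixed moments of the path.
    Independence and the Poisson law of the increments give
    E [N s | N t = n] = n s / t and, for s <= u,
    E [N s N u | N t = n] = n s / t + n (n - 1) s u / t ^ 2
    ([conditional_mean], [conditional_product_mean]). These are the moments of a
    sum of n independent indicators of U_i <= s. By Tonelli
    ([ge0_integral_sqr]), the first two conditional moments of the fractional
    integral are then a simple and a double integral of these expressions
    against the kernel (t - s) ^ (alpha - 1).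

    To evaluate the double integral, s and min s u are written back as
    the integrals over v of the indicators of v <= s and of v <= min s u. The
    same Tonelli identity, read backwards, turns the double integral into
    the integral over v of the square of (t - v) ^ alpha / alpha
    ([kernel_above_pair_total]). So all that has to be integrated is a power of
    t - v, with a possible singularity at v = t, which [ge0_FTC2_oo] handles. *)

(** * Binomial thinning of Poisson weights *)

(** The Poisson probabilities without their exponential factor. The factors
    exp (- a) of the independent increments multiply to the one of the total,
    so conditioning on the total cancels them and leaves only these weights;
    at a = 0 they give the point mass at 0, which covers the degenerate
    intervals s = u or u = t. *)
Definition weight (R : realType) (a : R) (k : nat) : R := a ^+ k / k`!%:R.

(** Size-biasing: multiplying by k shifts the index. The factorial moments of
    a conditioned Poisson increment come from this identity alone. *)
Lemma weightS (R : realType) (a : R) (k : nat) :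
  k.+1%:R * weight a k.+1 = a * weight a k.
Proof.
rewrite /weight factS natrM exprS.
have k0 : k`!%:R != 0 :> R by rewrite pnatr_eq0 -lt0n fact_gt0.
have k1 : k.+1%:R != 0 :> R by rewrite pnatr_eq0.
by field; rewrite k0 nat1r.
Qed.

Lemma weight0 (R : realType) (k : nat) : weight (0 : R) k = (k == 0)%:R.
Proof. by case: k => [|k]; rewrite /weight ?expr0n ?mul0r// fact0 divr1. Qed.

(** The binomial theorem: sums of independent Poisson variables are Poisson. *)
Lemma weight_conv (R : realType) (a b : R) (m : nat) :
  \sum_(i < m.+1) weight a i * weight b (m - i) = weight (a + b) m.
Proof.
rewrite {3}/weight addrC exprDn mulr_suml; apply: eq_bigr => i _.
rewrite /weight -mulr_natr.
have im : (i <= m)%N by rewrite -ltnS.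
have f0 j : j`!%:R != 0 :> R by rewrite pnatr_eq0 -lt0n fact_gt0.
rewrite -(bin_fact im) !natrM.
by field; rewrite !f0 pnatr_eq0 -lt0n bin_gt0 im.
Qed.

(** Given that two independent Poisson variables of rates a and b sum to m, the
    first is binomial with success probability a / (a + b); this is its mean.
    When a + b = 0 both sides vanish, as 0 / 0 = 0. *)
Lemma weight_conv_mean (R : realType) (a b : R) (m : nat) :
  (a + b = 0 -> a = 0) ->
  \sum_(i < m.+1) i%:R * (weight a i * weight b (m - i)) =
  m%:R * (a / (a + b)) * weight (a + b) m.
Proof.
move=> ab0; case: m => [|m]; first by rewrite big_ord1 !mul0r.
rewrite big_ord_recl mul0r add0r.
under eq_bigr => i _.
  rewrite lift0 mulrA weightS -mulrA subSS; over.
rewrite -mulr_sumr weight_conv.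
have [c0|c0] := eqVneq (a + b) 0; first by rewrite (ab0 c0) !(mul0r, mulr0).
by rewrite mulrAC weightS; field.
Qed.

(** The second moment of the same binomial law, in the form
    m p + m (m - 1) p ^ 2. Peeling off one factor i by size-biasing reduces it
    to the mean for m - 1. *)
Lemma weight_conv_square (R : realType) (a b : R) (m : nat) :
  (a + b = 0 -> a = 0) ->
  \sum_(i < m.+1) i%:R ^+ 2 * (weight a i * weight b (m - i)) =
  (m%:R * (a / (a + b)) + m%:R * (m%:R - 1) * (a / (a + b)) ^+ 2)
  * weight (a + b) m.
Proof.
move=> ab0; case: m => [|m]; first by rewrite big_ord1 !mul0r expr0n !mul0r addr0 mul0r.
rewrite big_ord_recl expr0n mul0r add0r.
under eq_bigr => i _.
  rewrite lift0 expr2 -(mulrA i.+1%:R) (mulrA i.+1%:R (weight _ _)).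
  rewrite weightS subSS -(mulrA a) mulrCA -natr1 mulrDl mul1r.
  over.
rewrite -mulr_sumr big_split/= weight_conv weight_conv_mean//.
have [c0|c0] := eqVneq (a + b) 0.
  by rewrite (ab0 c0) !(mul0r, mulr0, expr0n, addr0).
have -> : a * (m%:R * (a / (a + b)) * weight (a + b) m + weight (a + b) m) =
  (a / (a + b) + m%:R * (a / (a + b)) ^+ 2) * ((a + b) * weight (a + b) m).
  by field.
by rewrite -weightS -natr1; ring.
Qed.

(** * Integrals of powers with an end-point singularity *)

(** The second fundamental theorem of calculus for a nonnegative integrand that
    may be unbounded, or discontinuous, at both end points, such as
    (t - s) ^ (alpha - 1) for alpha < 1. The compact version applies on the
    segments [a + e_n, b - e_n], and monotone convergence passes to their
    union. *)
Lemma ge0_FTC2_oo (R : realType) (f F : R -> R) (a b : R) : a < b ->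
  (forall x, a < x < b -> 0 <= f x) ->
  (forall x, a < x < b -> {for x, continuous f}) ->
  (forall x, a < x < b -> derivable F x 1) ->
  (forall x, a < x < b -> derive1 F x = f x) ->
  F x @[x --> a^'+] --> F a -> F x @[x --> b^'-] --> F b ->
  (\int[lebesgue_measure]_(x in `[a, b]) (f x)%:E = (F b - F a)%:E)%E.
Proof.
move=> ab f0 cf dF Ff Fa Fb.
have mf : measurable_fun `]a, b[ (EFin \o f).
  apply/measurable_EFinP; apply: open_continuous_measurable_fun => // x.
  by rewrite inE/= in_itv/= => /cf.
rewrite integral_itv_bndoo//.
(* The offset is n + 3 so that e_n < (b - a) / 2 and the segments are proper. *)
pose e n : R := (b - a) / n.+3%:R.
have e0 n : 0 < e n by rewrite divr_gt0// subr_gt0.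
have e2 n : e n < (b - a) / 2.
  by rewrite ltr_pM2l ?subr_gt0// ltf_pV2 ?posrE// ltr_nat.
have ecvg : e n @[n --> \oo] --> (0 : R).
  rewrite -(mulr0 (b - a)); apply: cvgM; first exact: cvg_cst.
  have := @cvg_harmonic R; rewrite -(cvg_shiftn 2); apply: cvg_trans.
  by apply: near_eq_cvg; apply: nearW => n; rewrite /= addn2.
have eb n : a < a + e n /\ a + e n < b - e n /\ b - e n < b.
  by have := e0 n; have := e2 n; move: (e n) => x; lra.
pose E n : set R := `[a + e n, b - e n]%classic.
have sub n x : E n x -> a < x < b.
  move=> /= xE; have : x \in `[a + e n, b - e n] := xE.
  rewrite in_itv/=. move=> /andP[h1 h2].
  by have [? [? ?]] := eb n; apply/andP; split; lra.
have EU : `]a, b[%classic = \bigcup_n E n.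
  apply/seteqP; split => x /=.
    rewrite in_itv/= => /andP[ax xb].
    have d0 : 0 < Num.min (x - a) (b - x) by rewrite lt_min !subr_gt0 ax xb.
    have [n _ /(_ n (leqnn n))/=] := (cvgr0Pnorm_lt _).1 ecvg _ d0.
    rewrite gtr0_norm// lt_min => /andP[h1 h2].
    by exists n => //; rewrite /E/= in_itv/=; apply/andP; split; lra.
  by move=> [n _] /sub; rewrite in_itv.
have En n : (\int[lebesgue_measure]_(x in E n) (f x)%:E =
             (F (b - e n) - F (a + e n))%:E)%E.
  have [ae [aebe be]] := eb n.
  have dE x : x \in `[a + e n, b - e n] -> a < x < b by move=> xE; apply: (sub n).
  rewrite (@continuous_FTC2 _ f F)//.
  - apply: continuous_in_subspaceT => x /[!inE] /sub; exact: cf.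
  - have cF x : x \in `[a + e n, b - e n] -> {for x, continuous F}.
      move=> /dE /dF dFx.
      by apply: differentiable_continuous; rewrite -derivable1_diffP.
    split.
    + by move=> x xE; apply/dF/dE/subset_itv_oo_cc.
    + by apply: cvg_at_right_filter; apply: cF; rewrite in_itv/= lexx ltW.
    + by apply: cvg_at_left_filter; apply: cF; rewrite in_itv/= lexx ltW.
  - by move=> x xE; apply/Ff/dE/subset_itv_oo_cc.
have h : (\int[lebesgue_measure]_(x in E n) (f x)%:E)%E @[n --> \oo] -->
    (\int[lebesgue_measure]_(x in `]a, b[) (f x)%:E)%E.
  rewrite EU; apply: ge0_nondecreasing_set_cvg_integral => //.
  - apply/nondecreasing_seqP => n; rewrite subsetEset => x; rewrite /E/= !in_itv/=.
    have : e n.+1 <= e n by rewrite ler_pM2l ?subr_gt0// lef_pV2 ?posrE// ler_nat.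
    by move=> h /andP[h1 h2]; apply/andP; split; lra.
  - by move=> n; exact: measurable_itv.
  - move=> n; apply: measurable_funS mf => //.
    by move=> x /sub; rewrite /= in_itv.
  - by move=> n x /sub; rewrite lee_fin; exact: f0.
suff : (\int[lebesgue_measure]_(x in E n) (f x)%:E)%E @[n --> \oo] -->
    (F b - F a)%:E by move=> h2; apply: (cvg_unique _ h h2); exact: ereal_hausdorff.
under eq_cvg do rewrite En.
apply: cvg_EFin; first exact: nearW.
apply: cvgB.
  move/cvg_at_leftP : Fb; apply; split; first by move=> n; have [_ []] := eb n.
  by rewrite -[X in _ --> X]subr0; apply: cvgB => //; exact: cvg_cst.
move/cvg_at_rightP : Fa; apply; split; first by move=> n; have [] := eb n.
by rewrite -[X in _ --> X]addr0; apply: cvgD => //; exact: cvg_cst.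
Qed.

Lemma integral_if (d : measure_display) (T : measurableType d) (R : realType)
    (m : {measure set T -> \bar R}) (p : T -> bool) (f : T -> R) :
  (\int[m]_x (if p x then f x else 0)%:E = \int[m]_(x in [set x | p x]) (f x)%:E)%E.
Proof.
rewrite [RHS]integral_mkcond; apply: eq_integral => x _.
by rewrite patchE mem_setE -[x \in p]/(p x); case: (p x).
Qed.

Lemma integral_powR_itv0 (R : realType) (b x : R) : 0 < b -> 0 < x ->
  (\int[lebesgue_measure]_(u in `[0%R, x]) (u `^ (b - 1))%:E = (x `^ b / b)%:E)%E.
Proof.
move=> b0 x0.
have dpow (u : R) : 0 < u -> is_derive u 1 (fun u : R => u `^ b / b) (u `^ (b - 1)).
  move=> u0; have h := is_derive1_powR b u0.
  have : is_derive u 1 (fun u : R => b^-1 *: (u `^ b)) (b^-1 *: (b * u `^ (b - 1))).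
    exact: is_deriveZ.
  rewrite (_ : b^-1 *: _ = u `^ (b - 1)).
    by under eq_fun do rewrite /GRing.scale/= mulrC.
  by rewrite /GRing.scale/= mulrA mulVf ?mul1r ?gt_eqF.
have cont (u : R) : 0 < u -> {for u, continuous (fun u : R => u `^ b / b)}.
  by move=> /dpow[ds _]; apply: differentiable_continuous; rewrite -derivable1_diffP.
rewrite (@ge0_FTC2_oo _ _ (fun u : R => u `^ b / b))//.
- by rewrite powR0 ?gt_eqF// mul0r subr0.
- by move=> u _; exact: powR_ge0.
- move=> u /andP[u0 _]; apply: differentiable_continuous.
  by apply/derivable1_diffP/derivable_powR; rewrite in_itv/= u0.
- by move=> u /andP[u0 _]; have [] := dpow u u0.
- by move=> u /andP[u0 _]; rewrite derive1E; have [_ ->] := dpow u u0.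
- rewrite powR0 ?gt_eqF//.
  by apply: cvgM; [exact: powR_cvg0|exact: cvg_cst].
- by apply: cvg_at_left_filter; exact: (cont x x0).
Qed.

Lemma integral_powR_sub (R : realType) (b t v : R) : 0 < b -> v <= t ->
  (\int[lebesgue_measure]_(s in `[v, t]) ((t - s) `^ (b - 1))%:E =
   ((t - v) `^ b / b)%:E)%E.
Proof.
move=> b0; rewrite le_eqVlt => /predU1P[->|vt].
  by rewrite subrr powR0 ?gt_eqF// mul0r set_itv1 integral_set1.
have pos (s : R) : v < s < t -> 0 < t - s by case/andP => _ st; rewrite subr_gt0.
have dsub (s : R) : is_derive s 1 (fun s : R => t - s) (-1 : R).
  by rewrite -[X in is_derive _ _ _ X]sub0r; apply: is_deriveB.
have dpow (s : R) : s < t ->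
    is_derive s 1 (fun s : R => - ((t - s) `^ b / b)) ((t - s) `^ (b - 1)).
  move=> st; have ts : 0 < t - s by rewrite subr_gt0.
  have h := @is_derive1_comp R _ _ s _ _ (is_derive1_powR b ts) (dsub s).
  have : is_derive s 1 (fun s : R => (- b^-1) *: ((t - s) `^ b))
    ((- b^-1) *: ((b * (t - s) `^ (b - 1)) * -1)) by exact: is_deriveZ.
  rewrite (_ : _ *: (_ * -1) = (t - s) `^ (b - 1)).
    by under eq_fun do rewrite /GRing.scale/= mulNr mulrC.
  by rewrite /GRing.scale/=; field; rewrite gt_eqF.
have cont (s : R) : s < t -> {for s, continuous (fun s : R => - ((t - s) `^ b / b))}.
  by move=> /dpow[ds _]; apply: differentiable_continuous; rewrite -derivable1_diffP.
rewrite (@ge0_FTC2_oo _ _ (fun s : R => - ((t - s) `^ b / b)))//.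
- by rewrite subrr powR0 ?gt_eqF// mul0r oppr0 sub0r opprK.
- by move=> s _; exact: powR_ge0.
- move=> s /pos ts; have [h _] :=
    @is_derive1_comp R _ _ s _ _ (is_derive1_powR (b - 1) ts) (dsub s).
  by apply: differentiable_continuous; rewrite -derivable1_diffP.
- by move=> s /andP[_ /dpow[]].
- by move=> s /andP[_ /dpow[_ h]]; rewrite derive1E.
- by apply: cvg_at_right_filter; exact: cont.
- rewrite subrr powR0 ?gt_eqF//.
  apply: cvgN; apply: cvgM; last exact: cvg_cst.
  apply/cvg_at_leftP => u [ut ucvg].
  move/cvg_at_rightP : (powR_cvg0 b0); apply; split.
    by move=> n; rewrite subr_gt0.
  by rewrite -(subrr t); apply: cvgB => //; exact: cvg_cst.
Qed.

Lemma integral_expRN_itvy (R : realType) (u : R) :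
  (\int[lebesgue_measure]_(x in `[u, +oo[) (expR (- x))%:E = (expR (- u))%:E)%E.
Proof.
have cE : continuous (fun z : R => expR (- z)).
  by move=> z; apply: continuous_comp; [exact: opp_continuous|exact: continuous_expR].
rewrite (@ge0_continuous_FTC2y _ _ (fun x => - expR (- x)) _ 0)//.
- by rewrite EFinN oppeK add0e.
- exact: continuous_subspaceT.
- by rewrite -oppr0; apply: cvgN; exact: cvgr_expR.
- by apply: cvgN; apply/cvg_at_right_filter; exact: cE.
- move=> x _; rewrite derive1E.
  have h := @is_derive1_comp R _ _ x _ _ (is_derive_expR (- x)) (is_deriveNid x 1).
  have [_ /= ->] := @is_deriveN _ _ _ _ x 1 _ h.
  by rewrite mulrN1 opprK.
Qed.

(** * The functional equation of the Gamma function *)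

(** Both sides come from integrating u ^ (b - 1) * exp (- x) over the region
    0 < u <= x, first in u or first in x; an integration by parts would need
    limits of the boundary terms at 0 and at infinity. The identity is obtained
    in the extended reals, where [fine] sends +oo to 0 on both sides. *)
Lemma GammaS (R : realType) (b : R) : 0 < b -> Gamma (b + 1) = b * Gamma b.
Proof.
move=> b0; have bN0 : b != 0 by rewrite gt_eqF.
pose f (z : R * R) : \bar R :=
  (if (0 < z.1) && (z.1 <= z.2) then z.1 `^ (b - 1) * expR (- z.2) else 0)%:E.
have f0 z : (0 <= f z)%E.
  by rewrite lee_fin; case: ifP => // _; rewrite mulr_ge0 ?powR_ge0 ?expR_ge0.
have mpow c : measurable_fun setT (fun u : R => u `^ c).
  exact: measurable_powR.
have mexp : measurable_fun setT (fun u : R => expR (- u)).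
  by apply: measurableT_comp.
have empow (D : set R) : measurable_fun D (EFin \o (fun u : R => u `^ (b - 1))).
  by apply/measurable_EFinP/measurable_funTS.
have emexp (D : set R) : measurable_fun D (EFin \o (fun u : R => expR (- u))).
  by apply/measurable_EFinP/measurable_funTS.
have mf : measurable_fun setT f.
  apply/measurable_EFinP; apply: measurable_fun_ifT => //.
  - apply: measurable_and.
      by apply: measurable_fun_ltr => //; exact: measurable_fst.
    by apply: measurable_fun_ler; [exact: measurable_fst|exact: measurable_snd].
  - apply: measurable_funM.
      by apply: (measurableT_comp (mpow (b - 1))); exact: measurable_fst.
    by apply: (measurableT_comp mexp); exact: measurable_snd.
have over_u (x : R) : (\int[lebesgue_measure]_u f (u, x) =
    (if 0 < x then x `^ b * expR (- x) / b else 0)%:E)%E.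
  case: ltP => [x0|x0]; last first.
    rewrite integral0_eq// => u _; rewrite /f/=; case: ifP => // /andP[u0 ux].
    by have := lt_le_trans u0 (le_trans ux x0); rewrite ltxx.
  rewrite integral_if/= (_ : [set u | _] = `]0, x]%classic); last first.
    by apply/seteqP; split => u /=; rewrite in_itv.
  rewrite integral_itv_obnd_cbnd; last first.
    have /measurable_EFinP m :
        measurable_fun `]0, x] (fun u : R => u `^ (b - 1) * expR (- x)).
      by apply: measurable_funM => //; exact: measurable_funTS.
    exact: m.
  under eq_integral do rewrite EFinM.
  rewrite ge0_integralZr//; last 2 first.
  - exact: empow.
  - by move=> u _; rewrite lee_fin powR_ge0.
  by rewrite integral_powR_itv0// -EFinM mulrAC.
have over_x (u : R) : (\int[lebesgue_measure]_x f (u, x) =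
    (if 0 < u then u `^ (b - 1) * expR (- u) else 0)%:E)%E.
  case: ltP => [u0|u0]; last first.
    by rewrite integral0_eq// => x _; rewrite /f/= ltNge u0.
  under eq_integral do rewrite /f/= u0 /=.
  rewrite integral_if/= (_ : [set x | _] = `[u, +oo[%classic); last first.
    by apply/seteqP; split => x /=; rewrite in_itv/= andbT.
  under eq_integral do rewrite EFinM.
  rewrite ge0_integralZl//; last 2 first.
  - exact: emexp.
  - by rewrite lee_fin powR_ge0.
  by rewrite integral_expRN_itvy.
have := @fubini_tonelli _ _ _ _ _ (@lebesgue_measure R) (@lebesgue_measure R) f mf f0.
under eq_integral do rewrite over_x.
under [RHS]eq_integral do rewrite over_u.
rewrite !integral_if => H.
have intE c : Gamma c = fine (\int[lebesgue_measure]_(x in [set x : R | (0 < x)%R])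
    (x `^ (c - 1) * expR (- x))%:E)%E.
  rewrite /Gamma /Rintegral; congr (fine (integral _ _ _)).
  by apply/seteqP; split => x /=; rewrite in_itv/= andbT.
rewrite !intE H addrK.
under [in RHS]eq_integral do rewrite EFinM.
rewrite ge0_integralZr//.
- have : (0 < b^-1%:E)%E by rewrite lte_fin invr_gt0.
  case: integral => [r _|h|h].
  + by rewrite -EFinM /= mulrCA divff// mulr1.
  + by rewrite gt0_mulye//= mulr0.
  + by rewrite gt0_mulNye//= mulr0.
- rewrite -(_ : `]0, +oo[%classic = [set x : R | 0 < x])//.
  by apply/seteqP; split => x /=; rewrite in_itv/= andbT.
- have /measurable_EFinP m : measurable_fun [set x : R | 0 < x]
      (fun x : R => x `^ b * expR (- x)).
    by apply: measurable_funM; exact: measurable_funTS.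
  exact: m.
- by move=> x _; rewrite lee_fin mulr_ge0 ?powR_ge0 ?expR_ge0.
- by rewrite lee_fin invr_ge0 ltW.
Qed.

(** * Second moments of integrals *)

(** Tonelli applied twice: the square of an integral is a double integral, so
    the second moment of a random integral is the double integral of the mixed
    second moments of the integrand. *)
Lemma ge0_integral_sqr (d1 d2 : measure_display) (T1 : measurableType d1)
    (T2 : measurableType d2) (R : realType)
    (m1 : {sigma_finite_measure set T1 -> \bar R})
    (m2 : {sigma_finite_measure set T2 -> \bar R})
    (f : T1 * T2 -> \bar R) :
  measurable_fun setT f -> (forall z, 0 <= f z)%E ->
  (\int[m2]_y (\int[m1]_x f (x, y) * \int[m1]_x f (x, y)) =
   \int[m1]_x \int[m1]_x' \int[m2]_y (f (x, y) * f (x', y)))%E.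
Proof.
move=> mf f0.
pose G y := (\int[m1]_x f (x, y))%E.
have mG : measurable_fun setT G.
  by apply: measurable_fun_fubini_tonelli_G.
have G0 y : (0 <= G y)%E by apply: integral_ge0.
have mfl x : measurable_fun setT (fun y => f (x, y)).
  by apply: measurableT_comp => //; exact: pair1_measurable.
have mfr y : measurable_fun setT (fun x => f (x, y)).
  by apply: measurableT_comp => //; exact: pair2_measurable.
transitivity (\int[m2]_y \int[m1]_x (f (x, y) * G y))%E.
  by apply: eq_integral => y _; rewrite ge0_integralZr.
rewrite -(@fubini_tonelli _ _ _ _ _ m1 m2 (fun z => f z * G z.2)%E); last 2 first.
- by apply: emeasurable_funM => //; apply: measurableT_comp.
- by move=> z; rewrite mule_ge0.
apply: eq_integral => x _ /=.
transitivity (\int[m2]_y \int[m1]_x' (f (x, y) * f (x', y)))%E.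
  by apply: eq_integral => y _; rewrite ge0_integralZl.
rewrite -(@fubini_tonelli _ _ _ _ _ m1 m2 (fun z => f (x, z.2) * f z)%E)//.
- by apply: emeasurable_funM => //; apply: (measurableT_comp (mfl x)).
- by move=> z; rewrite mule_ge0.
Qed.

Lemma variance_from_moments (d : measure_display) (T : measurableType d)
    (R : realType) (P : probability T R) (X : T -> R) (m1 m2 : R) :
  measurable_fun setT X ->
  (\int[P]_w (X w)%:E = m1%:E)%E -> (\int[P]_w (X w ^+ 2)%:E = m2%:E)%E ->
  'V_P[X] = (m2 - m1 ^+ 2)%:E.
Proof.
move=> mX E1 E2.
have X2 : X \in Lfun P 2%:E.
  rewrite inE; apply/andP; split; rewrite inE//=.
  rewrite /finite_norm unlock /Lnorm/= poweR_lty//.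
  under eq_integral => w _.
    rewrite powR_mulrn// real_normK ?num_real//; over.
  by rewrite E2 ltry.
by rewrite varianceE// unlock E1 E2 -EFinB.
Qed.

(** * Conditional moments of the Poisson process *)

Lemma increment_distribution (d : measure_display) (R : realType)
    (T : measurableType d) (P : probability T R) (lambda : R)
    (N : R -> {RV P >-> nat}) (s t : R) (k : nat) :
  0 < lambda -> poisson_process lambda N -> 0 <= s -> s <= t ->
  P [set w | (N t w - N s w)%N = k] =
  (weight (lambda * (t - s)) k * expR (- (lambda * (t - s))))%:E.
Proof.
move=> l0 HN s0; rewrite le_eqVlt => /predU1P[<-|st].
  rewrite subrr mulr0 oppr0 expR0 mulr1 weight0.
  under [X in P X]eq_set do rewrite subnn.
  case: k => [|k]; first by rewrite (_ : [set _ | _] = setT) ?probability_setT// -subTset.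
  by rewrite (_ : [set _ | _] = set0) ?measure0// -subset0 => w.
rewrite (poisson_increment_distribution HN)// /poisson_pmf.
by rewrite mulr_gt0 ?subr_gt0.
Qed.

(** The independence of the increments over 0 <= s <= u <= t determines the
    joint law of N s, N u and N t, because N 0 = 0. *)
Lemma three_increments (d : measure_display) (R : realType)
    (T : measurableType d) (P : probability T R) (lambda : R)
    (N : R -> {RV P >-> nat}) (s u t : R) (i j l : nat) :
  0 < lambda -> poisson_process lambda N -> 0 <= s -> s <= u -> u <= t ->
  P [set w | [/\ N s w = i, (N u w - N s w)%N = j & (N t w - N u w)%N = l]] =
  (weight (lambda * s) i * weight (lambda * (u - s)) j *
   weight (lambda * (t - u)) l * expR (- (lambda * t)))%:E.
Proof.
move=> l0 HN s0 su ut.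
pose tau := nth t [:: 0; s; u].
have tau_mono m : tau m <= tau m.+1 by case: m => [|[|[|m]]]//=; rewrite /tau/= nth_nil.
have := @poisson_independent_increments _ _ _ _ _ _ HN 3 tau (lexx _) tau_mono
  (fun m => [set (nth l [:: i; j] m)]) (fun=> I).
rewrite !big_ord_recl big_ord0 mule1 /tau/= /preimage/=.
rewrite (increment_distribution _ l0 HN)// (increment_distribution _ l0 HN)//.
rewrite (increment_distribution _ l0 HN)//; last exact: le_trans su.
rewrite subr0 -!EFinM => E.
transitivity (P (\bigcap_(i0 in [set: 'I_3])
        [set w | (N (tau i0.+1) w - N (tau i0) w)%N = nth l [:: i; j] i0])).
  congr (P _); apply/seteqP; split => w /=.
    move=> [h1 h2 h3] [[|[|[|m]]] hm] _ //=.
    by rewrite (poisson_start HN) subn0.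
  move=> h; split.
  - by have := h (@Ordinal 3 0 isT) I; rewrite /= (poisson_start HN) subn0.
  - by have := h (@Ordinal 3 1 isT) I.
  - by have := h (@Ordinal 3 2 isT) I.
rewrite E; congr EFin.
have -> : expR (- (lambda * t)) = expR (- (lambda * s)) * (expR (- (lambda * (u - s))) *
    expR (- (lambda * (t - u)))).
  by rewrite -!expRD; congr expR; ring.
by ring.
Qed.

Lemma conditional_probabilityE (d : measure_display) (R : realType)
    (T : measurableType d) (P : probability T R) (A : set T)
    (mA : measurable A) (p : R) (B : set T) : P A = p%:E -> 0 < p ->
  conditional_probability P mA B = (P (B `&` A) * (p^-1)%:E)%E.
Proof.
move=> PA p0; rewrite /conditional_probability /= /mnormalize /= /mrestr setTI PA.
by rewrite eqe gt_eqF.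
Qed.

Lemma sum_delta (R : pzSemiRingType) (n m : nat) (g : nat -> R) : (m <= n)%N ->
  \sum_(j < n.+1) g j * (m == j)%:R = g m.
Proof.
move=> mn; rewrite (bigD1 (inord m))//= inordK ?ltnS// eqxx mulr1.
rewrite big1 ?addr0// => j jm; case: eqP => [mj|]; last by rewrite mulr0.
by move: jm; rewrite mj inord_val eqxx.
Qed.

Lemma measurable_nat_fun (R : realType) (g : nat -> R) : measurable_fun setT g.
Proof. by []. Qed.

(** Given N t = n, the pair (N s, N u) takes only the finitely many values
    i <= j <= n, so its conditional expectations are finite sums; the factor
    exp (- lambda t) cancels. *)
Lemma conditional_pair_expectation (d : measure_display) (R : realType)
    (T : measurableType d) (P : probability T R) (lambda : R)
    (N : R -> {RV P >-> nat}) (s u t : R) (n : nat) (f : nat -> nat -> R) :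
  0 < lambda -> poisson_process lambda N ->
  0 <= s -> s <= u -> u <= t -> 0 < t -> (forall i j, 0 <= f i j) ->
  measurable_fun setT (fun w => f (N s w) (N u w)) ->
  (\int[conditional_probability P (measurable_event (N t) n)]_w
     (f (N s w) (N u w))%:E =
   ((\sum_(j < n.+1) \sum_(i < j.+1) f i j *
      (weight (lambda * s) i * weight (lambda * (u - s)) (j - i) *
       weight (lambda * (t - u)) (n - j))) / weight (lambda * t) n)%:E)%E.
Proof.
move=> l0 HN s0 su ut t0 f0 mf.
have t00 := ltW t0; have u0 := le_trans s0 su.
have PA : P [set w | N t w = n] = (weight (lambda * t) n * expR (- (lambda * t)))%:E.
  have := increment_distribution n l0 HN (lexx 0) t00.
  by rewrite subr0 => <-; under [in RHS]eq_set do rewrite (poisson_start HN) subn0.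
have w0 : 0 < weight (lambda * t) n.
  by rewrite /weight divr_gt0// ?exprn_gt0 ?mulr_gt0// ltr0n fact_gt0.
have p0 := mulr_gt0 w0 (expR_gt0 (- (lambda * t))).
have := fun B => conditional_probabilityE (measurable_event (N t) n) B PA p0.
(* Only the values of Q on events matter from here on. *)
move: (conditional_probability P _) => Q QE.
pose B i j := [set w | N s w = i] `&` [set w | N u w = j].
have mB i j : measurable (B i j) by apply: measurableI; exact: measurable_event.
have QB i j : (i <= j)%N -> (j <= n)%N -> Q (B i j) =
    (weight (lambda * s) i * weight (lambda * (u - s)) (j - i) *
       weight (lambda * (t - u)) (n - j) / weight (lambda * t) n)%:E.
  move=> ij jn; rewrite QE.
  rewrite (_ : _ `&` _ = [set w | [/\ N s w = i, (N u w - N s w)%N = (j - i)%N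
      & (N t w - N u w)%N = (n - j)%N]]); last first.
    apply/seteqP; split => w /= => [[[<- <-] <-]//|[h1 h2 h3]].
    move: (poisson_nondecreasing HN w s0 su) (poisson_nondecreasing HN w u0 ut).
    have nat_sub (a b c : nat) : a = i -> (b - a = j - i)%N -> (c - b = n - j)%N ->
        (a <= b)%N -> (b <= c)%N -> (a = i /\ b = j) /\ c = n by lia.
    exact: nat_sub.
  rewrite (three_increments _ _ _ l0 HN)// -EFinM; congr EFin; field.
  by rewrite gt_eqF// expR_eq0.
pose h w : R := \sum_(j < n.+1) \sum_(i < j.+1) f i j * \1_(B i j) w.
transitivity (\int[Q]_w (h w)%:E)%E.
  apply: ge0_ae_eq_integral => //.
  - exact/measurable_EFinP.
  - apply/measurable_EFinP; apply: measurable_sum => j; apply: measurable_sum => i.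
    by apply: measurable_funM => //; exact: measurable_indic.
  - by move=> w _; rewrite lee_fin.
  - move=> w _; rewrite lee_fin; apply: sumr_ge0 => j _; apply: sumr_ge0 => i _.
    by rewrite mulr_ge0.
  - exists (~` [set w | N t w = n]); split.
    + by apply: measurableC; exact: measurable_event.
    + by have := QE (~` [set w | N t w = n]); rewrite setICl measure0 mul0e.
    + move=> w /=; apply: contra_not => Ntw _; congr EFin.
      have sw := poisson_nondecreasing HN w s0 su.
      have := poisson_nondecreasing HN w u0 ut; rewrite Ntw => uw.
      rewrite -[LHS](sum_delta (f (N s w)) uw); apply: eq_bigr => j _.
      have [<-|/eqP uj] := eqVneq (N u w) j; last first.
        rewrite mulr0 big1// => i _; rewrite indicE memNset ?mulr0//.
        by case.
      rewrite mulr1 -[LHS](sum_delta (f ^~ (N u w)) sw); apply: eq_bigr => i _.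
      congr (_ * _); rewrite indicE; congr (_%:R); congr nat_of_bool.
      by apply/eqP/idP => [<-|]; rewrite inE//; case.
rewrite /h.
under eq_integral do rewrite -sumEFin.
rewrite ge0_integral_sum//; last 2 first.
- move=> j; apply/measurable_EFinP; apply: measurable_sum => i.
  by apply: measurable_funM => //; exact: measurable_indic.
- move=> j w _; rewrite lee_fin; apply: sumr_ge0 => i _.
  by rewrite mulr_ge0.
rewrite mulr_suml -sumEFin; apply: eq_bigr => j _.
under eq_integral do rewrite -sumEFin.
rewrite ge0_integral_sum//; last 2 first.
- by move=> i; apply/measurable_EFinP; apply: measurable_funM.
- by move=> i w _; rewrite lee_fin mulr_ge0.
rewrite mulr_suml -sumEFin; apply: eq_bigr => i _.
under eq_integral do rewrite EFinM.
rewrite ge0_integralZl//; last 2 first.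
- by apply/measurable_EFinP; exact: measurable_indic.
- by rewrite lee_fin.
transitivity ((f i j)%:E * Q (B i j))%E; first by rewrite integral_indic// setIT.
by rewrite (QB i j (ltn_ord i) (ltn_ord j)) -EFinM -!mulrA.
Qed.

Lemma thinned_mean (R : realType) (lambda s u : R) (j : nat) :
  0 < lambda -> 0 <= s -> s <= u ->
  \sum_(i < j.+1) i%:R *
     (weight (lambda * s) i * weight (lambda * (u - s)) (j - i)) =
  j%:R * (s / u) * weight (lambda * u) j.
Proof.
move=> l0 s0 su; have lN0 : lambda != 0 by rewrite gt_eqF.
have lu : lambda * s + lambda * (u - s) = lambda * u by ring.
rewrite weight_conv_mean lu.
  by rewrite -mulf_div divff// mul1r.
move/eqP; rewrite mulf_eq0 (negbTE lN0)/= => /eqP u0.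
by rewrite (_ : s = 0) ?mulr0//; apply/eqP; rewrite eq_le s0 -u0 su.
Qed.

Lemma thinned_square (R : realType) (lambda s u : R) (j : nat) :
  0 < lambda -> 0 <= s -> s <= u ->
  \sum_(i < j.+1) i%:R ^+ 2 *
     (weight (lambda * s) i * weight (lambda * (u - s)) (j - i)) =
  (j%:R * (s / u) + j%:R * (j%:R - 1) * (s / u) ^+ 2) * weight (lambda * u) j.
Proof.
move=> l0 s0 su; have lN0 : lambda != 0 by rewrite gt_eqF.
have lu : lambda * s + lambda * (u - s) = lambda * u by ring.
rewrite weight_conv_square lu.
  by rewrite -mulf_div divff// mul1r.
move/eqP; rewrite mulf_eq0 (negbTE lN0)/= => /eqP u0.
by rewrite (_ : s = 0) ?mulr0//; apply/eqP; rewrite eq_le s0 -u0 su.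
Qed.

Lemma conditional_mean (d : measure_display) (R : realType)
    (T : measurableType d) (P : probability T R) (lambda : R)
    (N : R -> {RV P >-> nat}) (s t : R) (n : nat) :
  0 < lambda -> poisson_process lambda N -> 0 <= s -> s <= t -> 0 < t ->
  (\int[conditional_probability P (measurable_event (N t) n)]_w (N s w)%:R%:E =
   (n%:R * (s / t))%:E)%E.
Proof.
move=> l0 HN s0 st t0; have t00 := ltW t0.
rewrite (@conditional_pair_expectation _ _ _ _ lambda N s t t n (fun i j => i%:R))//.
  congr EFin; under eq_bigr => j _.
    under eq_bigr => i _ do rewrite mulrA.
    rewrite -mulr_suml thinned_mean//.
    rewrite (_ : _ * _ = (s / t) * (j%:R *
      (weight (lambda * t) j * weight (lambda * (t - t)) (n - j)))); last by ring.
    over.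
  rewrite -mulr_sumr thinned_mean// divff ?gt_eqF// mulr1 mulrCA mulrA mulfK 1?mulrC//.
  by rewrite gt_eqF// /weight divr_gt0// ?exprn_gt0 ?mulr_gt0// ltr0n fact_gt0.
by apply: measurableT_comp => //; exact: measurable_nat_fun.
Qed.

(** The Markov property makes this two successive thinnings: given N u = j, the
    mean of N s is j s / u, so what remains is s / u times the second moment of
    N u given N t = n. *)
Lemma conditional_product_mean (d : measure_display) (R : realType)
    (T : measurableType d) (P : probability T R) (lambda : R)
    (N : R -> {RV P >-> nat}) (s u t : R) (n : nat) :
  0 < lambda -> poisson_process lambda N ->
  0 <= s -> s <= u -> u <= t -> 0 < t ->
  (\int[conditional_probability P (measurable_event (N t) n)]_w
     ((N s w)%:R * (N u w)%:R)%:E =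
   (n%:R * (s / t) + n%:R * (n%:R - 1) * ((s / t) * (u / t)))%:E)%E.
Proof.
move=> l0 HN s0 su ut t0; have u0 := le_trans s0 su.
have regroup (x y A B C : R) : x * y * (A * B * C) = y * (x * (A * B) * C).
  by ring.
rewrite (@conditional_pair_expectation _ _ _ _ lambda N s u t n
  (fun i j => i%:R * j%:R))//.
  congr EFin; under eq_bigr => j _.
    under eq_bigr => i _ do rewrite regroup.
    rewrite -mulr_sumr -mulr_suml thinned_mean//.
    rewrite (_ : _ * _ = (s / u) * (j%:R ^+ 2 *
      (weight (lambda * u) j * weight (lambda * (t - u)) (n - j)))); last by ring.
    over.
  rewrite -mulr_sumr thinned_square//.
  rewrite mulrA mulfK; last first.
    by rewrite gt_eqF// /weight divr_gt0// ?exprn_gt0 ?mulr_gt0// ltr0n fact_gt0.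
  have [u00|uN0] := eqVneq u 0.
    have -> : s = 0 by apply/eqP; rewrite eq_le s0 -u00 su.
    by rewrite !mul0r !mulr0 addr0.
  by field; rewrite uN0 gt_eqF.
by apply: measurable_funM; apply: measurableT_comp => //; exact: measurable_nat_fun.
Qed.

(** Monotone right-continuous paths are determined by their values at rational
    times; this is what makes the process jointly measurable. *)
Lemma path_ge_rational (d : measure_display) (R : realType)
    (T : measurableType d) (P : probability T R) (lambda : R)
    (N : R -> {RV P >-> nat}) (s : R) (w : T) (m : nat) :
  poisson_process lambda N -> 0 <= s ->
  (m <= N s w)%N <-> forall q : rat, s < ratr q -> (m <= N (ratr q) w)%N.
Proof.
move=> HN s0; split=> [ms q sq|h].
  exact: leq_trans ms (poisson_nondecreasing HN w s0 (ltW sq)).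
have nb : nbhs (N s w) [set N s w].
  by rewrite nbhs_principalE.
have [e /= e0 he] := poisson_right_continuous HN s0 nb.
have : s < s + e by rewrite ltrDl.
move=> /rat_in_itvoo[q]; rewrite in_itv/= => /andP[sq qe].
have := h q sq; rewrite (he (ratr q))//=.
by rewrite /ball/= ltr0_norm ?subr_lt0// opprB ltrBlDl.
Qed.

(** Joint measurability in time and chance, which Tonelli needs. Times are
    truncated at 0 because the paths are regular only on [0, +oo[. *)
Lemma measurable_paths (d : measure_display) (R : realType)
    (T : measurableType d) (P : probability T R) (lambda : R)
    (N : R -> {RV P >-> nat}) : poisson_process lambda N ->
  measurable_fun setT (fun z : R * T => (N (Num.max 0 z.1) z.2)%:R : R).
Proof.
move=> HN; pose M (z : R * T) : nat := N (Num.max 0 z.1) z.2.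
have mge m : measurable [set z | (m <= M z)%N].
  rewrite (_ : [set z | _] = \bigcap_(q in [set: rat])
      ([set z : R * T | ratr q <= Num.max 0 z.1] `|`
       [set z : R * T | (m <= N (ratr q) z.2)%N])); last first.
    apply/seteqP; split => z /=.
      have z0 : 0 <= Num.max 0 z.1 by rewrite le_max lexx.
      move=> /(path_ge_rational _ _ HN z0) h q _ /=.
      by case: (leP (ratr q) (Num.max 0 z.1)) => [|/h]; [left|right].
    have z0 : 0 <= Num.max 0 z.1 by rewrite le_max lexx.
    move=> h; apply/(path_ge_rational _ _ HN z0) => q sq.
    by case: (h q I) => //=; rewrite leNgt sq.
  rewrite -[X in measurable X]setCK setC_bigcap; apply: measurableC.
  apply: bigcupT_measurable_rat => q; apply: measurableC; apply: measurableU.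
    rewrite -[X in measurable X]setTI.
    apply: (measurable_fun_le measurableT) => //.
    by apply: measurable_maxr => //; exact: measurable_fst.
  rewrite -[X in measurable X]/(snd @^-1` [set w | (m <= N (ratr q) w)%N]).
  rewrite -[X in measurable X]setTI.
  apply: measurable_snd => //.
  rewrite -[X in measurable X]/(N (ratr q) @^-1` [set k | (m <= k)%N]).
  exact: measurable_funPTI.
have mM : measurable_fun setT M.
  move=> _ Y _; rewrite setTI.
  rewrite (_ : M @^-1` Y = \bigcup_(m in Y)
      ([set z | (m <= M z)%N] `\` [set z | (m.+1 <= M z)%N])).
    by apply: bigcup_measurable => m _; apply: measurableD.
  apply/seteqP; split => z /=.
    by move=> Yz; exists (M z) => //; split => //=; rewrite ltnn.
  move=> [m Ym [/= h1 h2]]; suff <- : m = M z by [].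
  by apply/eqP; rewrite eqn_leq h1/= leqNgt; apply/negP.
by apply: (measurableT_comp (@measurable_nat_fun R (fun k => k%:R)) mM).
Qed.

(** * The kernel and the contribution of one jump *)

(** The weight of the fractional integral over [0, t], extended by 0 so that all
    integrals run over the whole line. *)
Definition kernel (R : realType) (alpha t s : R) : R :=
  if (0 <= s) && (s <= t) then (t - s) `^ (alpha - 1) else 0.

Lemma kernel_ge0 (R : realType) (alpha t s : R) : 0 <= kernel alpha t s.
Proof. by rewrite /kernel; case: ifP => // _; exact: powR_ge0. Qed.

Lemma measurable_kernel (R : realType) (alpha t : R) :
  measurable_fun setT (kernel alpha t).
Proof.
apply: measurable_fun_ifT => //.
  by apply: measurable_and; apply: measurable_fun_ler.
apply: (measurableT_comp (measurable_powR _ )).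
by apply: measurable_funB.
Qed.

(** Given N t = n, the jump times are n independent uniform points of [0, t].
    A single point v contributes to the fractional integral the kernel
    restricted to the times s >= v. The indicator of 0 <= v <= s plays the role
    of the path of a process with one uniform jump, up to the factor t. *)
Definition kernel_above (R : realType) (alpha t : R) (z : R * R) : R :=
  if (0 <= z.2) && (z.2 <= z.1) then kernel alpha t z.1 else 0.

Lemma kernel_above_ge0 (R : realType) (alpha t : R) z :
  0 <= kernel_above alpha t z.
Proof. by rewrite /kernel_above; case: ifP => // _; exact: kernel_ge0. Qed.

Lemma measurable_kernel_above (R : realType) (alpha t : R) :
  measurable_fun setT (kernel_above alpha t).
Proof.
apply: measurable_fun_ifT => //.
  apply: measurable_and; apply: measurable_fun_ler => //;
    by [exact: measurable_fst|exact: measurable_snd].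
by apply: (measurableT_comp (measurable_kernel _ _)); exact: measurable_fst.
Qed.

Lemma integral_step (R : realType) (c s : R) : 0 <= s ->
  (\int[lebesgue_measure]_v (if (0 <= v)%R && (v <= s)%R then c else 0)%:E =
   (c * s)%:E)%E.
Proof.
move=> s0; rewrite integral_if (_ : [set v | _] = `[0, s]%classic); last first.
  by apply/seteqP; split => v /=; rewrite in_itv.
rewrite integral_cst//= lebesgue_measure_itv/= lte_fin EFinM.
case: ltP => [_|s1]; first by rewrite sube0.
by rewrite (_ : s = 0)//; apply/eqP; rewrite eq_le s0 s1.
Qed.

Lemma kernel_above_mean (R : realType) (alpha t s : R) :
  (\int[lebesgue_measure]_v (kernel_above alpha t (s, v))%:E =
   (kernel alpha t s * s)%:E)%E.
Proof.
have [s0|s0] := leP 0 s; first by rewrite -integral_step.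
have k0 : kernel alpha t s = 0 by rewrite /kernel leNgt s0.
rewrite k0 mul0r integral0_eq// => v _.
by rewrite /kernel_above/= k0; case: ifP.
Qed.

Lemma kernel_above_product_mean (R : realType) (alpha t s u : R) :
  (\int[lebesgue_measure]_v
      ((kernel_above alpha t (s, v))%:E * (kernel_above alpha t (u, v))%:E) =
   (kernel alpha t s * kernel alpha t u * Num.min s u)%:E)%E.
Proof.
have [m0|m0] := leP 0 (Num.min s u).
  rewrite -integral_step//; apply: eq_integral => v _.
  rewrite -EFinM /kernel_above/= le_min; congr EFin.
  by case: (0 <= v); case: (v <= s); case: (v <= u); rewrite /= ?(mulr0, mul0r).
have k0 : kernel alpha t s * kernel alpha t u = 0.
  move: m0; rewrite gt_min /kernel => /orP[] h; rewrite !(leNgt 0) h/= ?mul0r ?mulr0//.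
rewrite k0 mul0r integral0_eq// => v _; rewrite -EFinM /kernel_above/=.
by case: ifP; case: ifP; rewrite ?(mulr0, mul0r, k0).
Qed.

(** The contribution (t - v) ^ alpha / alpha of a point v, up to the factor
    1 / Gamma alpha. *)
Lemma kernel_above_integral (R : realType) (alpha t v : R) : 0 < alpha ->
  (\int[lebesgue_measure]_s (kernel_above alpha t (s, v))%:E =
   (if (0 <= v)%R && (v <= t)%R then (t - v) `^ alpha / alpha else 0)%:E)%E.
Proof.
move=> a0; case: ifPn => [/andP[v0 vt]|vt].
  rewrite -integral_powR_sub//.
  rewrite (_ : `[v, t]%classic = [set s | (v <= s) && (s <= t)]); last first.
    by apply/seteqP; split => s /=; rewrite in_itv.
  rewrite -integral_if; apply: eq_integral => s _; congr EFin.
  rewrite /kernel_above/= v0/= /kernel.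
  by case: (leP v s) => //= vs; rewrite (le_trans v0 vs).
rewrite integral0_eq// => s _; rewrite /kernel_above/= /kernel.
case: ifP => // /andP[v0 vs]; case: ifP => // /andP[_ st].
by move: vt; rewrite v0 (le_trans vs st).
Qed.

Lemma integral_sub_powR_scaled (R : realType) (b c t : R) :
  0 < b -> 0 < c -> 0 < t ->
  (\int[lebesgue_measure]_(v in `[0%R, t]) ((t - v) `^ b / c)%:E =
   (t `^ (b + 1) / (b + 1) / c)%:E)%E.
Proof.
move=> b0 c0 t0; under eq_integral do rewrite EFinM.
rewrite ge0_integralZr//.
- have := @integral_powR_sub R (b + 1) t 0.
  by rewrite addrK subr0 => ->//; [rewrite addr_gt0|exact: ltW].
- apply/measurable_EFinP; apply: (measurableT_comp (measurable_powR b)).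
  by apply: measurable_funB.
- by move=> v _; rewrite lee_fin powR_ge0.
- by rewrite lee_fin invr_ge0 ltW.
Qed.

(** The first moment of the contribution of one point. Exchanging the integrals
    turns it into an integral of a power of t - v. *)
Lemma kernel_above_total (R : realType) (alpha t : R) : 0 < alpha -> 0 < t ->
  (\int[lebesgue_measure]_s \int[lebesgue_measure]_v
      (kernel_above alpha t (s, v))%:E =
   (t `^ (alpha + 1) / (alpha + 1) / alpha)%:E)%E.
Proof.
move=> a0 t0.
rewrite (@fubini_tonelli _ _ _ _ _ (@lebesgue_measure R) (@lebesgue_measure R)
  (fun z => (kernel_above alpha t z)%:E)); last 2 first.
- by apply/measurable_EFinP; exact: measurable_kernel_above.
- by move=> z; rewrite lee_fin kernel_above_ge0.
under eq_integral do rewrite kernel_above_integral//.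
rewrite integral_if (_ : [set v | _] = `[0, t]%classic); last first.
  by apply/seteqP; split => v /=; rewrite in_itv.
by rewrite integral_sub_powR_scaled.
Qed.

(** The second moment of the contribution of one point: the double integral of
    the kernels against min s u is the integral of the square of
    (t - v) ^ alpha / alpha, so no case distinction between s <= u and u <= s
    has to be integrated. *)
Lemma kernel_above_pair_total (R : realType) (alpha t : R) :
  0 < alpha -> 0 < t ->
  (\int[lebesgue_measure]_s \int[lebesgue_measure]_u
      (kernel alpha t s * kernel alpha t u * Num.min s u)%:E =
   (t `^ (2 * alpha + 1) / (2 * alpha + 1) / alpha ^+ 2)%:E)%E.
Proof.
move=> a0 t0.
under eq_integral do under eq_integral do rewrite -kernel_above_product_mean.
rewrite -(@ge0_integral_sqr _ _ _ _ R (@lebesgue_measure R) (@lebesgue_measure R)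
  (fun z => (kernel_above alpha t z)%:E)); last 2 first.
- by apply/measurable_EFinP; exact: measurable_kernel_above.
- by move=> z; rewrite lee_fin kernel_above_ge0.
under eq_integral do rewrite !kernel_above_integral//.
transitivity (\int[lebesgue_measure]_v (if (0 <= v)%R && (v <= t)%R then
    (t - v) `^ (2 * alpha) / alpha ^+ 2 else 0)%:E)%E.
  apply: eq_integral => v _; rewrite -EFinM; congr EFin.
  case: ifP => _; last by rewrite mulr0.
  rewrite mulr_natl mulr2n powRD; last by rewrite gt_eqF ?addr_gt0.
  by field; rewrite gt_eqF.
rewrite integral_if (_ : [set v | _] = `[0, t]%classic); last first.
  by apply/seteqP; split => v /=; rewrite in_itv.
by rewrite integral_sub_powR_scaled// ?mulr_gt0// exprn_gt0.
Qed.

Lemma iterated_integral_linear (d1 d2 : measure_display)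
    (T1 : measurableType d1) (T2 : measurableType d2) (R : realType)
    (m1 : {sigma_finite_measure set T1 -> \bar R})
    (m2 : {sigma_finite_measure set T2 -> \bar R})
    (f g : T1 * T2 -> R) (a b : R) :
  measurable_fun setT f -> measurable_fun setT g ->
  (forall z, 0 <= f z) -> (forall z, 0 <= g z) -> 0 <= a -> 0 <= b ->
  (\int[m1]_x \int[m2]_y (a * f (x, y) + b * g (x, y))%:E =
   a%:E * \int[m1]_x \int[m2]_y (f (x, y))%:E +
   b%:E * \int[m1]_x \int[m2]_y (g (x, y))%:E)%E.
Proof.
move=> mf mg f0 g0 a0 b0.
have fub (h : T1 * T2 -> R) : measurable_fun setT h -> (forall z, 0 <= h z) ->
    (\int[m1]_x \int[m2]_y (h (x, y))%:E = \int[m1 \x m2]_z (h z)%:E)%E.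
  move=> mh h0; rewrite (@fubini_tonelli1 _ _ _ _ _ m1 m2 (fun z => (h z)%:E))//.
  exact/measurable_EFinP.
rewrite (fub (fun z => a * f z + b * g z)); last 2 first.
- by apply: measurable_funD; apply: measurable_funM.
- by move=> z; rewrite addr_ge0// mulr_ge0.
rewrite (fub f)// (fub g)//.
under eq_integral do rewrite EFinD.
rewrite ge0_integralD//; last 4 first.
- by move=> z _; rewrite lee_fin mulr_ge0.
- by apply/measurable_EFinP; apply: measurable_funM.
- by move=> z _; rewrite lee_fin mulr_ge0.
- by apply/measurable_EFinP; apply: measurable_funM.
under eq_integral do rewrite EFinM.
under [X in (_ + X)%E]eq_integral do rewrite EFinM.
rewrite !ge0_integralZl//; try exact/measurable_EFinP; by move=> z _; rewrite lee_fin.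
Qed.

(** * Conditional moments of the fractional integral *)

Lemma measurable_kernel_path (d : measure_display) (R : realType)
    (T : measurableType d) (P : probability T R) (lambda : R)
    (N : R -> {RV P >-> nat}) (alpha t : R) : poisson_process lambda N ->
  measurable_fun setT (fun z : R * T => kernel alpha t z.1 * (N z.1 z.2)%:R).
Proof.
move=> HN.
rewrite (_ : (fun z => _) =
  (fun z : R * T => kernel alpha t z.1 * (N (Num.max 0 z.1) z.2)%:R)).
  apply: measurable_funM; last exact: measurable_paths HN.
  by apply: (measurableT_comp (measurable_kernel _ _)); exact: measurable_fst.
apply/funext => z; rewrite /kernel; by case: (leP 0 z.1) => z0 //; rewrite !mul0r.
Qed.

Lemma fractional_integral_kernel (d : measure_display) (R : realType)
    (T : measurableType d) (P : probability T R)
    (N : R -> {RV P >-> nat}) (alpha t : R) (w : T) :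
  fractional_integral alpha N t w = (Gamma alpha)^-1 *
    fine (\int[lebesgue_measure]_s (kernel alpha t s * (N s w)%:R)%:E)%E.
Proof.
rewrite /fractional_integral /Rintegral; congr (_ * fine _).
rewrite (_ : `[0, t]%classic = [set s | (0 <= s) && (s <= t)]); last first.
  by apply/seteqP; split => s /=; rewrite in_itv.
rewrite -integral_if; apply: eq_integral => s _; rewrite /kernel.
by case: ifP; rewrite ?mul0r.
Qed.

Lemma conditional_mean_kernel (d : measure_display) (R : realType)
    (T : measurableType d) (P : probability T R) (lambda : R)
    (N : R -> {RV P >-> nat}) (alpha s t : R) (n : nat) :
  0 < lambda -> poisson_process lambda N -> 0 < t ->
  (\int[conditional_probability P (measurable_event (N t) n)]_w
     (kernel alpha t s * (N s w)%:R)%:E =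
   (n%:R / t)%:E * (kernel alpha t s * s)%:E)%E.
Proof.
move=> l0 HN t0; have [/andP[s0 st]|st] := boolP ((0 <= s) && (s <= t)).
  under eq_integral do rewrite EFinM.
  rewrite ge0_integralZl//.
  - rewrite (conditional_mean _ l0 HN)// -!EFinM; congr EFin.
    by field; rewrite gt_eqF.
  - apply/measurable_EFinP; apply: (measurableT_comp (@measurable_nat_fun R _)).
    by [].
  - by rewrite lee_fin kernel_ge0.
have k0 : kernel alpha t s = 0 by rewrite /kernel (negbTE st).
by rewrite k0 mul0r mule0 integral0_eq// => w _; rewrite mul0r.
Qed.

(** The first term on the right is n times the mixed moment of one uniform point,
    and the second is n (n - 1) times the product of its means. *)
Lemma conditional_product_mean_kernel (d : measure_display) (R : realType)
    (T : measurableType d) (P : probability T R) (lambda : R)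
    (N : R -> {RV P >-> nat}) (alpha s u t : R) (n : nat) :
  0 < lambda -> poisson_process lambda N -> 0 < t ->
  (\int[conditional_probability P (measurable_event (N t) n)]_w
     ((kernel alpha t s * (N s w)%:R)%:E * (kernel alpha t u * (N u w)%:R)%:E) =
   (n%:R / t * (kernel alpha t s * kernel alpha t u * Num.min s u) +
    n%:R * (n%:R - 1) / t ^+ 2 *
      ((kernel alpha t s * s) * (kernel alpha t u * u)))%:E)%E.
Proof.
move=> l0 HN t0; wlog su : s u / s <= u.
  move=> H; case/orP: (le_total s u) => [/H//|us].
  under eq_integral do rewrite muleC.
  by rewrite H// minC; congr EFin; ring.
rewrite (min_idPl su).
have [/andP[s0 ut]|st] := boolP ((0 <= s) && (u <= t)); last first.
  have k0 : kernel alpha t s = 0 \/ kernel alpha t u = 0.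
    move: st; rewrite negb_and => /orP[] /negbTE h; [left|right];
      by rewrite /kernel h ?andbF.
  rewrite integral0_eq; last first.
    by move=> w _; case: k0 => ->; rewrite mul0r ?(mul0e, mule0).
  by case: k0 => ->; rewrite !(mul0r, mulr0, addr0).
under eq_integral do rewrite -EFinM mulrACA EFinM.
rewrite ge0_integralZl//.
- rewrite (conditional_product_mean _ l0 HN)// -!EFinM; congr EFin.
  by field; rewrite gt_eqF.
- apply/measurable_EFinP; apply: measurable_funM;
    apply: (measurableT_comp (@measurable_nat_fun R _)); by [].
- by rewrite lee_fin mulr_ge0 ?kernel_ge0.
Qed.

(** The path is bounded by its last value N t w on [0, t] and the kernel is
    integrable, so the integral is finite for every outcome and not only
    almost surely. *)
Lemma kernel_path_fin_num (d : measure_display) (R : realType)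
    (T : measurableType d) (P : probability T R) (lambda : R)
    (N : R -> {RV P >-> nat}) (alpha t : R) (w : T) :
  poisson_process lambda N -> 0 < alpha -> 0 < t ->
  (\int[lebesgue_measure]_s (kernel alpha t s * (N s w)%:R)%:E \is a fin_num)%E.
Proof.
move=> HN a0 t0.
have mk : measurable_fun setT (EFin \o kernel alpha t).
  by apply/measurable_EFinP; exact: measurable_kernel.
have kE : (\int[lebesgue_measure]_s (kernel alpha t s)%:E =
    (t `^ alpha / alpha)%:E)%E.
  have := kernel_above_integral t 0 a0; rewrite lexx ltW//= subr0 => <-.
  apply: eq_integral => s _; congr EFin; rewrite /kernel_above/= lexx /kernel.
  by case: (0 <= s).
have F0 s : (0 <= (kernel alpha t s * (N s w)%:R)%:E)%E.
  by rewrite lee_fin mulr_ge0 ?kernel_ge0.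
rewrite ge0_fin_numE; last exact: integral_ge0.
apply: (@le_lt_trans _ _ (\int[lebesgue_measure]_s
    ((kernel alpha t s)%:E * (N t w)%:R%:E))%E).
  apply: ge0_le_integral => //.
  - have m := measurable_kernel_path alpha t HN.
    apply: (measurableT_comp _ (pair2_measurable w) : measurable_fun setT
      ((EFin \o (fun z => kernel alpha t z.1 * (N z.1 z.2)%:R)) \o
       (fun s : R => (s, w)))).
    exact/measurable_EFinP.
  - exact: emeasurable_funM.
  - move=> s _; rewrite -EFinM lee_fin /kernel.
    case: ifP => [/andP[s0 st]|_]; last by rewrite !mul0r.
    apply: ler_wpM2l; first exact: powR_ge0.
    by rewrite ler_nat; exact: (poisson_nondecreasing HN w s0 st).
rewrite ge0_integralZr//; last by move=> s _; rewrite lee_fin kernel_ge0.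
by rewrite kE -EFinM ltry.
Qed.

Lemma kernel_path_mean (d : measure_display) (R : realType)
    (T : measurableType d) (P : probability T R) (lambda : R)
    (N : R -> {RV P >-> nat}) (alpha t : R) (n : nat) :
  0 < lambda -> poisson_process lambda N -> 0 < alpha -> 0 < t ->
  (\int[conditional_probability P (measurable_event (N t) n)]_w
     \int[lebesgue_measure]_s (kernel alpha t s * (N s w)%:R)%:E =
   (n%:R / t * (t `^ (alpha + 1) / (alpha + 1) / alpha))%:E)%E.
Proof.
move=> l0 HN a0 t0; set Q := conditional_probability _ _.
rewrite -(@fubini_tonelli _ _ _ _ _ (@lebesgue_measure R) Q
  (fun z => (kernel alpha t z.1 * (N z.1 z.2)%:R)%:E)); last 2 first.
- by apply/measurable_EFinP; exact: (measurable_kernel_path _ _ HN).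
- by move=> z; rewrite lee_fin mulr_ge0 ?kernel_ge0.
under eq_integral do rewrite (conditional_mean_kernel _ _ _ l0 HN)//.
have ks0 s : 0 <= kernel alpha t s * s.
  by rewrite /kernel; case: ifP => [/andP[s0 _]|]; rewrite ?mul0r// mulr_ge0 ?powR_ge0.
rewrite ge0_integralZl//.
- rewrite [in RHS]EFinM -kernel_above_total//; congr (_ * _)%E.
  by apply: eq_integral => s _; rewrite kernel_above_mean.
- apply/measurable_EFinP; apply: measurable_funM => //; exact: measurable_kernel.
- by move=> s _; rewrite lee_fin.
- by rewrite lee_fin; apply: divr_ge0 => //; exact: ltW.
Qed.

(** With I1 and I2 the integrals of the contribution of one point and of its
    square, the right-hand side is (n / t) I2 + n (n - 1) (I1 / t) ^ 2. *)
Lemma kernel_path_second_moment (d : measure_display) (R : realType)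
    (T : measurableType d) (P : probability T R) (lambda : R)
    (N : R -> {RV P >-> nat}) (alpha t : R) (n : nat) :
  0 < lambda -> poisson_process lambda N -> 0 < alpha -> 0 < t ->
  (\int[conditional_probability P (measurable_event (N t) n)]_w
     (\int[lebesgue_measure]_s (kernel alpha t s * (N s w)%:R)%:E *
      \int[lebesgue_measure]_s (kernel alpha t s * (N s w)%:R)%:E) =
   (n%:R / t * (t `^ (2 * alpha + 1) / (2 * alpha + 1) / alpha ^+ 2) +
    n%:R * (n%:R - 1) / t ^+ 2 *
      (t `^ (alpha + 1) / (alpha + 1) / alpha) ^+ 2)%:E)%E.
Proof.
move=> l0 HN a0 t0; set Q := conditional_probability _ _.
rewrite (@ge0_integral_sqr _ _ _ _ _ (@lebesgue_measure R) Q
  (fun z => (kernel alpha t z.1 * (N z.1 z.2)%:R)%:E)); last 2 first.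
- by apply/measurable_EFinP; exact: (measurable_kernel_path _ _ HN).
- by move=> z; rewrite lee_fin mulr_ge0 ?kernel_ge0.
under eq_integral do under eq_integral do
  rewrite (conditional_product_mean_kernel _ _ _ _ l0 HN)//.
have ks0 s : 0 <= kernel alpha t s * s.
  by rewrite /kernel; case: ifP => [/andP[s0 _]|]; rewrite ?mul0r// mulr_ge0 ?powR_ge0.
have mk := measurable_kernel alpha t.
have mks : measurable_fun setT (fun s => kernel alpha t s * s).
  exact: measurable_funM.
have emks : measurable_fun setT (EFin \o (fun s => kernel alpha t s * s)).
  exact/measurable_EFinP.
have mk1 : measurable_fun setT (fun z : R * R => kernel alpha t z.1).
  by apply: (measurableT_comp mk); exact: measurable_fst.
have mk2 : measurable_fun setT (fun z : R * R => kernel alpha t z.2).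
  by apply: (measurableT_comp mk); exact: measurable_snd.
rewrite (@iterated_integral_linear _ _ _ _ R (@lebesgue_measure R) (@lebesgue_measure R)
  (fun z => kernel alpha t z.1 * kernel alpha t z.2 * Num.min z.1 z.2)
  (fun z => (kernel alpha t z.1 * z.1) * (kernel alpha t z.2 * z.2))); first last.
- case: n {Q} => [|n]; first by rewrite !mul0r.
  apply: divr_ge0; last by rewrite exprn_ge0// ltW.
  by apply: mulr_ge0 => //; rewrite subr_ge0 ler1n.
- by apply: divr_ge0 => //; exact: ltW.
- by move=> z; apply: mulr_ge0.
- move=> z /=; have [m0|m0] := leP 0 (Num.min z.1 z.2).
    by apply: mulr_ge0 => //; apply: mulr_ge0; exact: kernel_ge0.
  move: m0; rewrite gt_min /kernel => /orP[] h.
    by rewrite (leNgt 0 z.1) h !mul0r.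
  by rewrite (leNgt 0 z.2) h mulr0 mul0r.
- apply: measurable_funM.
    by apply: (measurableT_comp mks); exact: measurable_fst.
  by apply: (measurableT_comp mks); exact: measurable_snd.
- apply: measurable_funM; first exact: measurable_funM.
  by apply: measurable_minr; [exact: measurable_fst|exact: measurable_snd].
rewrite kernel_above_pair_total// EFinD EFinM (EFinM (_ / t ^+ 2)).
congr (_ + _ * _)%E.
have I1 : (\int[lebesgue_measure]_s (kernel alpha t s * s)%:E =
    (t `^ (alpha + 1) / (alpha + 1) / alpha)%:E)%E.
  by rewrite -kernel_above_total//; apply: eq_integral => s _; rewrite kernel_above_mean.
transitivity (\int[lebesgue_measure]_s ((kernel alpha t s * s)%:E *
    (t `^ (alpha + 1) / (alpha + 1) / alpha)%:E))%E.
  apply: eq_integral => s _ /=; under eq_integral do rewrite EFinM.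
  rewrite ge0_integralZl//; first by rewrite I1.
    by move=> u _; rewrite lee_fin.
  by rewrite lee_fin.
rewrite ge0_integralZr//; first by rewrite I1 -EFinM expr2.
  by move=> u _; rewrite lee_fin.
rewrite lee_fin; apply: divr_ge0; last exact: ltW.
by apply: divr_ge0; [exact: powR_ge0|apply: addr_ge0 => //; exact: ltW].
Qed.

Theorem theorem3p3 (d : measure_display) (R : realType)
    (T : measurableType d) (P : probability T R)
    (lambda : R) (N : R -> {RV P >-> nat}) (alpha : R)
    (lambda_gt0 : 0 < lambda) (HN : poisson_process lambda N)
    (alpha_gt0 : 0 < alpha) (t : R) (t_gt0 : 0 < t) (n : nat) :
  'V_(conditional_probability P (measurable_event (N t) n))
     [fractional_integral alpha N t] =
  (n%:R * t `^ (2 * alpha) * alpha ^+ 2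
     / ((2 * alpha + 1) * Gamma (alpha + 2) ^+ 2))%:E.
Proof.
pose Y w := (\int[lebesgue_measure]_s (kernel alpha t s * (N s w)%:R)%:E)%E.
have YE w : Y w = (fine (Y w))%:E.
  by rewrite fineK//; exact: (kernel_path_fin_num w HN alpha_gt0 t_gt0).
have mY : measurable_fun setT Y.
  apply: (@measurable_fun_fubini_tonelli_G _ _ _ _ _ (@lebesgue_measure R)
    (fun z => (kernel alpha t z.1 * (N z.1 z.2)%:R)%:E)).
  - by apply/measurable_EFinP; exact: (measurable_kernel_path _ _ HN).
  - by move=> z; rewrite lee_fin mulr_ge0 ?kernel_ge0.
have mfY : measurable_fun setT (fun w => fine (Y w)).
  exact: (measurableT_comp (fine_measurable measurableT)).
have XE : fractional_integral alpha N t = fun w => (Gamma alpha)^-1 * fine (Y w).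
  by apply/funext => w; rewrite fractional_integral_kernel.
have E1 := kernel_path_mean n lambda_gt0 HN alpha_gt0 t_gt0.
have E2 := kernel_path_second_moment n lambda_gt0 HN alpha_gt0 t_gt0.
move: (conditional_probability P _) E1 E2 => Q E1 E2.
pose c := (Gamma alpha)^-1.
have c0 : 0 <= c.
  rewrite invr_ge0; apply: fine_ge0; apply: integral_ge0 => x _.
  by rewrite lee_fin mulr_ge0 ?powR_ge0 ?expR_ge0.
have Y0 w : (0 <= Y w)%E.
  by apply: integral_ge0 => s _; rewrite lee_fin mulr_ge0 ?kernel_ge0.
pose p := t `^ alpha.
have pE : t `^ (alpha + 1) = p * t.
  by rewrite powRD ?powRr1 ?ltW// gt_eqF ?addr_gt0.
have ppE : t `^ (2 * alpha) = p ^+ 2.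
  by rewrite mulr_natl mulr2n powRD// gt_eqF ?addr_gt0.
have pptE : t `^ (2 * alpha + 1) = p ^+ 2 * t.
  by rewrite powRD ?powRr1 ?ltW// ?ppE// gt_eqF ?addr_gt0 ?mulr_gt0.
rewrite XE (@variance_from_moments _ _ _ _ _
  (c * (n%:R / t * (p * t / (alpha + 1) / alpha)))
  (c ^+ 2 * (n%:R / t * (p ^+ 2 * t / (2 * alpha + 1) / alpha ^+ 2) +
    n%:R * (n%:R - 1) / t ^+ 2 * (p * t / (alpha + 1) / alpha) ^+ 2))).
- have -> : alpha + 2 = alpha + 1 + 1 by ring.
  rewrite GammaS ?addr_gt0// GammaS// ppE /c; congr EFin.
  (* The inverse of 0 is 0, so both sides vanish if Gamma alpha does. *)
  have [->|g0] := eqVneq (Gamma alpha) 0; last first.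
    by field; rewrite g0 !gt_eqF ?addr_gt0 ?mulr_gt0.
  by rewrite !(invr0, mulr0, mul0r, expr0n, subr0)/=.
- exact: measurable_funM.
- under eq_integral do rewrite EFinM -YE.
  rewrite -pE EFinM -E1 /c.
  by rewrite ge0_integralZl// lee_fin.
- have sqE w : (((c * fine (Y w)) ^+ 2)%:E = (c ^+ 2)%:E * (Y w * Y w))%E.
    by rewrite exprMn EFinM; congr (_ * _)%E; rewrite expr2 EFinM -YE.
  under eq_integral do rewrite sqE.
  rewrite -pE -pptE [RHS]EFinM -E2.
  rewrite ge0_integralZl//.
  + exact: emeasurable_funM.
  + by move=> w _; apply: mule_ge0.
  + by rewrite lee_fin exprn_ge0.
Qed.
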